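(* For every $0<\varepsilon<10^{-5}$ and every sufficiently large integer $n$ the following holds. Let $p=p(n)$ satisfy $\frac{\ln n}{\varepsilon n}\le p\le 1$, let $d\in\mathbb{N}$, and let $\mathcal{P}=\mathcal{P}(n)$ be a monotone increasing graph property that is $(p,4\varepsilon)$-resilient. Suppose a $(1:\frac{\varepsilon}{30(d+1)p})$ Walker-Breaker game on $K_n$ is in progress, such that the graph $F$ of edges not yet claimed by either player satisfies $\delta(F)\ge(1-\varepsilon)n$, and Walker's current graph $W_0$ has the property that between every two vertices of $V(K_n)$ there is a path in $W_0$ of length at most $d$ (where these paths may use edges of $W_0$ not belonging to $K_n$). Then Walker has a strategy for continuing the game that creates a graph $W'\in\mathcal{P}$ (namely, the graph $W'$ of edges she claims from this point on has property $\mathcal{P}$).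
   Context: A $(1:b)$ Walker-Breaker game on $K_n$: Walker and Breaker alternately claim edges of $K_n$. Walker has a current position $v$; in her move she must choose an edge $vw$ incident with $v$ that has not been claimed by Breaker (it may have been claimed by Walker before, in which case she simply moves along it), claims it if not already hers, and $w$ becomes her new position. Breaker claims $b$ (or, when $b$ is not an integer, at most $b$) edges not yet claimed by either player in each move, without restriction. $\mathcal{G}_{n,p}$ denotes the Erdős–Rényi random graph on $n$ vertices where each edge is present independently with probability $p$; ''a.a.s.'' means with probability tending to $1$ as $n\to\infty$. A monotone increasing graph property $\mathcal{P}=\mathcal{P}(n)$ is $(p,\varepsilon)$-resilient if $G\sim\mathcal{G}_{n,p}$ a.a.s. has the following property: for every subgraph $R\subseteq G$ with $d_R(v)\le \varepsilon d_G(v)$ for every vertex $v$, the graph $G\setminus R$ has property $\mathcal{P}$. $\delta(F)$ denotes the minimum degree of $F$. *)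

(* Defs.v *)
From HB Require Import structures.
From mathcomp Require Import all_boot all_order all_algebra all_fingroup.
From mathcomp Require Import all_classical all_reals all_analysis.

Set Implicit Arguments.
Unset Strict Implicit.
Unset Printing Implicit Defensive.

Import Order.TTheory GRing.Theory Num.Theory.
Import numFieldNormedType.Exports.
Local Open Scope ring_scope.

(* A simple graph on the vertex set T is represented by its edge set
   G \subset complete_graph T, an edge being a two-element set of vertices. *)
Section Graphs.
Variable T : finType.
Implicit Types G : {set {set T}}.

Definition complete_graph : {set {set T}} := [set e : {set T} | #|e| == 2%N].

Definition degree G (v : T) : nat := #|[set e in G | v \in e]|.

(* Vertex degrees are below #|T|, so the neutral element plays no role when T
   is nonempty. *)
Definition min_degree G : nat := \big[minn/#|T|]_(v : T) degree G v.

Definition adj G : rel T := fun u v => [set u; v] \in G.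

Definition path_within G (d : nat) (u v : T) : Prop :=
  exists s : seq T,
    [/\ path (adj G) u s, uniq (u :: s), last u s = v & (size s <= d)%N].

End Graphs.
Arguments complete_graph T : clear implicits.

Definition relabel (T U : finType) (f : T -> U) (G : {set {set T}}) :
  {set {set U}} := [set f @: (e : {set T}) | e in G].

(* For an injection phi, seen as an embedding of the vertices of K_n into the
   vertices of a larger board, the part of G lying inside that copy of K_n. *)
Definition restrict_graph (n : nat) (T : finType) (phi : 'I_n -> T)
  (G : {set {set T}}) : {set {set 'I_n}} :=
  [set e in complete_graph 'I_n | phi @: e \in G].

Definition property := forall n : nat, pred {set {set 'I_n}}.

Definition graph_property (P : property) : Prop :=
  forall (n : nat) (f : {perm 'I_n}) (G : {set {set 'I_n}}),
    G \subset complete_graph 'I_n -> P n (relabel f G) = P n G.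

Definition monotone_increasing (P : property) : Prop :=
  forall (n : nat) (G G' : {set {set 'I_n}}),
    G \subset G' -> G' \subset complete_graph 'I_n -> P n G -> P n G'.

Section RandomGraphs.
Variable R : realType.

Definition Gnp_prob (n : nat) (p : R) (A : pred {set {set 'I_n}}) : R :=
  \sum_(G : {set {set 'I_n}} | (G \subset complete_graph 'I_n) && A G)
    p ^+ #|G| * (1 - p) ^+ #|complete_graph 'I_n :\: G|.

Definition robustly (P : property) (eps : R) (n : nat) :
  pred {set {set 'I_n}} := fun G =>
  [forall S : {set {set 'I_n}},
    (S \subset G) &&
      [forall v, (degree S v)%:R <= eps * (degree G v)%:R] ==>
    P n (G :\: S)].

Definition resilient (p : nat -> R) (eps : R) (P : property) : Prop :=
  (Gnp_prob (p n) (robustly P eps (n := n)) @[n --> \oo] --> (1 : R))%classic.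

End RandomGraphs.

Record position (T : finType) := Position {
  walker_edges : {set {set T}};
  breaker_edges : {set {set T}};
  location : T;
  walker_to_move : bool }.

Section Game.
Variables (R : realType) (T : finType) (board : {set {set T}}) (b : R).
Implicit Types s : position T.

Definition free_edges s : {set {set T}} :=
  board :\: (walker_edges s :|: breaker_edges s).

Definition walker_legal s (w : T) : bool :=
  [set location s; w] \in board :\: breaker_edges s.

(* Breaker takes exactly b edges when b is an integer (or all the free edges if
   fewer than b are left), and at most b edges otherwise. *)
Definition breaker_legal s (S : {set {set T}}) : Prop :=
  [/\ S \subset free_edges s, #|S|%:R <= b &
      forall k : nat, b = k%:R -> #|S| = minn k #|free_edges s|].

Variant step s : position T -> Prop :=
| WalkerStep w of walker_to_move s & walker_legal s w :
    step s (Position ([set location s; w] |: walker_edges s)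
                     (breaker_edges s) w false)
| BreakerStep S of ~~ walker_to_move s & breaker_legal s S :
    step s (Position (walker_edges s) (S :|: breaker_edges s)
                     (location s) true).

(* The positions arising in the course of the game; Walker may start at any
   vertex and either player may make the first move. *)
Inductive in_progress : position T -> Prop :=
| Start v first : in_progress (Position finset.set0 finset.set0 v first)
| Continue s s' of in_progress s & step s s' : in_progress s'.

(* A strategy maps the history, from the position where Walker adopts the
   strategy up to the current one, to the vertex she moves to. *)
Definition strategy := seq (position T) -> T.

Definition consistent (sigma : strategy) s0 (x : nat -> position T) (t : nat) :
  Prop :=
  x 0%N = s0 /\
  forall i, (i < t)%N ->
    step (x i) (x i.+1) /\
    (walker_to_move (x i) -> location (x i.+1) = sigma (mkseq x i.+1)).

(* The first clause says that sigma never prescribes an illegal move, so that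
   the second one is not satisfied for lack of plays. *)
Definition achieves (sigma : strategy) s0 (goal : pred (position T)) : Prop :=
  (forall x t, consistent sigma s0 x t -> walker_to_move (x t) ->
     walker_legal (x t) (sigma (mkseq x t.+1))) /\
  (forall x, (forall t, consistent sigma s0 x t) -> exists t, goal (x t)).

End Game.

(* Main.v *)
(** Walker generates a copy of G(n, p) by exposing the pairs of vertices one
    after the other, always at her current position [u]: an exposed edge that is
    free is walked along, one that is not free is lost.  The coin tosses are
    derandomised.  A potential bounds the conditional probability that the final
    graph is not robust, that some degree leaves the interval [9/10 np, 3 np], or
    that some vertex loses more than [18/5 eps np] edges; it is a supermartingale
    whatever Breaker does, starts below 1, and for each exposed pair Walker fixes
    the outcome that keeps it below 1.

    For this, Breaker must not own too many unexposed pairs at any vertex.  Each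
    time she has moved along a new edge (or exhausted [u]) Walker walks, inside
    her old graph and in at most [d] steps, to the vertex of largest danger
    [d_B(v) - beta c_v], where [c_v] counts the visits to [v] and
    [beta = 2 b (d + 1)].  As in the box game, every set of [k] vertices that
    still have unexposed pairs has total danger at most
    [beta k ln (n / k) + beta], so at most [5/4 eps n] of the pairs at a vertex
    are not free when they are exposed.  In the end the lost edges form a
    subgraph of degrees at most [4 eps d_G(v)], and resilience applies. *)

Require Import Defs.
From HB Require Import structures.
From mathcomp Require Import all_boot all_order all_algebra all_fingroup.
From mathcomp Require Import all_classical all_reals all_analysis.
From mathcomp Require Import fintype finset ring lra.

Set Implicit Arguments.
Unset Strict Implicit.
Unset Printing Implicit Defensive.

Import Order.TTheory GRing.Theory Num.Theory.
Import numFieldNormedType.Exports.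
Local Open Scope ring_scope.

(** * Reachability games: ranks of won positions and the strategies they yield *)

Section ReachabilityGames.
Variables (R : realType) (T : finType) (board : {set {set T}}) (b : R).
Variable goal : pred (position T).
Implicit Types s : position T.

Definition walk s w :=
  Position ([set location s; w] |: walker_edges s) (breaker_edges s) w false.

Definition reply s S :=
  Position (walker_edges s) (S :|: breaker_edges s) (location s) true.

Fixpoint wins_in (k : nat) s : Prop :=
  goal s \/
  if k is k'.+1 then
    if walker_to_move s then
      exists2 w, walker_legal board s w & wins_in k' (walk s w)
    else forall S, breaker_legal board b s S -> wins_in k' (reply s S)
  else False.

Definition wins s := exists k, wins_in k s.

Lemma wins_in_leq k k' s : (k <= k')%N -> wins_in k s -> wins_in k' s.
Proof.
elim: k k' s => [|k IHk] [|k'] s //=; first by move=> _ []; [left|].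
rewrite ltnS => lekk' [gs|H]; [by left|right].
move: H; case: (walker_to_move s) => [[w ws wk]|ks S legS].
  by exists w => //; apply: IHk wk.
exact: IHk (ks S legS).
Qed.

Lemma wins_goal s : goal s -> wins s.
Proof. by exists 0%N; left. Qed.

Lemma wins_walk s w :
  walker_to_move s -> walker_legal board s w -> wins (walk s w) -> wins s.
Proof. by move=> ms ls [k ks]; exists k.+1; right; rewrite ms; exists w. Qed.

(** Breaker has finitely many replies, so the ranks chosen for them have a maximum, which serves for
    all. *)
Lemma wins_reply s : ~~ walker_to_move s ->
  (forall S, breaker_legal board b s S -> wins (reply s S)) -> wins s.
Proof.
move=> ms H.
have [f fP] : {f : {set {set T}} -> nat &
    forall S, breaker_legal board b s S -> wins_in (f S) (reply s S)}.
  apply: (@choice _ _ (fun S k => breaker_legal board b s S -> wins_in k (reply s S))).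
  move=> S; have [lS|nlS] := pselect (breaker_legal board b s S).
    by have [k kP] := H S lS; exists k.
  by exists 0%N.
exists (\max_S f S).+1; right; rewrite (negbTE ms) => S lS.
exact: wins_in_leq (leq_bigmax S) (fP S lS).
Qed.

(** Breaker can never take an edge that Walker owns at her location. Walking back along it is always
    legal, so a strategy has a legal move even in positions that are not won. *)
Definition secure s :=
  walker_edges s \subset board :\: breaker_edges s /\
  exists w, [set location s; w] \in walker_edges s.

Lemma secure_legal s : secure s -> exists w, walker_legal board s w.
Proof. by case=> /subsetP sub [w wP]; exists w; apply: sub. Qed.

Lemma step_walker_sub s s' :
  walker_edges s \subset board :\: breaker_edges s -> step board b s s' ->
  walker_edges s' \subset board :\: breaker_edges s'.
Proof.
move=> sub []; last first.
  move=> S _ [Sfree _ _] /=; apply/subsetP => e eW.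
  move: (subsetP sub _ eW); rewrite !inE negb_or => /andP[-> ->].
  rewrite !andbT; apply/negP => /(subsetP Sfree); rewrite !inE eW.
  by [].
move=> w _ ls /=; apply/subsetP => e; rewrite in_setU1.
by case/orP=> [/eqP->|/(subsetP sub)].
Qed.

Lemma step_secure s s' : secure s -> step board b s s' -> secure s'.
Proof.
move=> [sub [w0 w0P]] st; split; first exact: step_walker_sub sub st.
case: st => [w ms ls|S ms [Sfree _ _]] /=; last by exists w0.
by exists (location s); rewrite setUC setU11.
Qed.

(* One move serves all ranks at once: the one that is optimal for the least
   rank of [s]. *)
Lemma uniform_winning_move s : walker_to_move s -> secure s ->
  exists2 w, walker_legal board s w &
    forall k, ~~ goal s -> wins_in k.+1 s -> wins_in k (walk s w).
Proof.
move=> ms secs; have [w lw] := secure_legal secs.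
have [gs|ngs] := boolP (goal s); first by exists w.
have [[k kP]|nk] := pselect (wins s); last first.
  by exists w => // k _ kP; case: nk; exists k.+1.
have exk : exists k, `[< wins_in k s >] by exists k; apply/asboolP.
case: (ex_minnP exk) => -[|m] /asboolP.
  by case=> // gs; rewrite gs in ngs.
move=> + min; case; first by move=> gs; rewrite gs in ngs.
rewrite ms => -[w' lw' mP]; exists w' => // k' _ k'P.
by apply: wins_in_leq mP; apply: (min k'.+1); apply/asboolP.
Qed.

(** The strategy is positional: it plays the move of [uniform_winning_move] at the last position of
    the history. Every move of either player lowers the rank by one until the goal holds. *)
Lemma wins_strategy s0 : secure s0 -> wins s0 ->
  exists sigma, achieves board b sigma s0 goal.
Proof.
move=> sec0 [k0 win0].
pose good s w := walker_legal board s w /\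
  forall k, ~~ goal s -> wins_in k.+1 s -> wins_in k (walk s w).
pose mv s := xget (location s) (good s).
have mvP s : walker_to_move s -> secure s -> good s (mv s).
  move=> ms secs; apply: xgetPex.
  by have [w lw wP] := uniform_winning_move ms secs; exists w.
pose sigma : strategy T := fun h => mv (last s0 h).
have sigmaE x t : sigma (mkseq x t.+1) = mv (x t).
  by rewrite /sigma -nth_last size_mkseq nth_mkseq.
have secx x t : consistent board b sigma s0 x t -> secure (x t).
  case=> x0 xP; suff: forall i, (i <= t)%N -> secure (x i) by apply.
  elim=> [|i IHi] it; first by rewrite x0.
  exact: step_secure (IHi (ltnW it)) (xP i it).1.
exists sigma; split=> [x t cx mx|x cx].
  by rewrite sigmaE; have [] := mvP _ mx (secx _ _ cx).
apply: contrapT => nogoal.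
have ng t : ~~ goal (x t) by apply/negP => gt; apply: nogoal; exists t.
have [x0 _] := cx 0%N.
(* At [t = k0] the rank is 0, which means that the goal holds. *)
suff H t : (t <= k0)%N -> wins_in (k0 - t) (x t).
  have := H k0 (leqnn _); rewrite subnn /= => -[] // g.
  by have := ng k0; rewrite g.
elim: t => [_|t IHt tk]; first by rewrite subn0 x0.
have := IHt (ltnW tk); rewrite -subSS subSn // => wt.
have [_ /(_ t (ltnSn t))[st stm]] := cx t.+1.
case: st stm => [w ms ls|S ms lS] /=.
  rewrite sigmaE => /(_ ms) ->.
  by have [_] := mvP _ ms (secx _ _ (cx t)); apply.
move=> _; case: wt => [g|]; first by have := ng t; rewrite g.
by rewrite (negbTE ms); apply.
Qed.

End ReachabilityGames.

(** * Degrees in simple graphs *)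

Section Degrees.
Variable T : finType.
Implicit Types (G E : {set {set T}}) (v : T).

Lemma degreeS G G' v : G \subset G' -> (degree G v <= degree G' v)%N.
Proof.
move=> sub; apply/subset_leq_card/subsetP => e; rewrite !inE.
by case/andP=> /(subsetP sub)-> ->.
Qed.

Lemma degreeU_le G G' v : (degree (G :|: G') v <= degree G v + degree G' v)%N.
Proof.
rewrite /degree; apply: leq_trans (leq_card_setU _ _).
by apply/subset_leq_card/subsetP => e; rewrite !inE -andb_orl.
Qed.

Lemma degreeU1 G e v :
  e \notin G -> degree (e |: G) v = ((v \in e) + degree G v)%N.
Proof.
move=> eG; rewrite /degree; have [ve|ve] := boolP (v \in e).
  have -> : [set e' in e |: G | v \in e'] = e |: [set e' in G | v \in e'].
    apply/setP => e'; rewrite !inE andb_orl; congr (_ || _).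
    by case: eqP => // ->.
  by rewrite cardsU1 !inE (negbTE eG).
rewrite add0n; congr #|pred_of_set _|; apply/setP => e'; rewrite !inE.
rewrite andb_orl; case: eqP => //= ->.
by rewrite (negbTE ve) andbF.
Qed.

Lemma degreeD1 G E e v : e \in G -> e \notin E ->
  degree (G :\: E) v = ((v \in e) + degree (G :\: (e |: E)) v)%N.
Proof.
move=> eG eE; rewrite -degreeU1; last by rewrite !inE eqxx.
congr degree; apply/setP => e'; rewrite !inE.
by case: eqP => //= ->; rewrite eG eE.
Qed.

Lemma degree0 v : degree (set0 : {set {set T}}) v = 0%N.
Proof. by apply: eq_card0 => e; rewrite !inE. Qed.

Lemma degreeID G G' v :
  (degree (G :&: G') v + degree (G :\: G') v = degree G v)%N.
Proof.
rewrite /degree -(cardsID G' [set e in G | v \in e]); congr addn;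
  congr #|pred_of_set _|; apply/setP => e; rewrite !inE; first by rewrite andbAC.
by rewrite andbA.
Qed.

(** Double counting: an edge has two ends, so it is counted at most twice. *)
Lemma sum_degree_le G (A : {set T}) : G \subset complete_graph T ->
  (\sum_(v in A) degree G v <= 2 * #|G|)%N.
Proof.
move=> /subsetP GK.
have -> : (\sum_(v in A) degree G v =
    \sum_(e in G) #|[set v in A | v \in e]|)%N.
  under eq_bigr do rewrite /degree -sum1dep_card big_mkcondr /=.
  rewrite exchange_big /=; apply: eq_bigr => e _.
  by rewrite -sum1dep_card big_mkcondr.
rewrite mulnC -sum_nat_const; apply: leq_sum => e /GK.
rewrite inE => /eqP <-; apply/subset_leq_card/subsetP => v.
by rewrite inE => /andP[].
Qed.

Lemma edgeP (e : {set T}) v : e \in complete_graph T -> v \in e ->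
  exists w, e = [set v; w].
Proof.
rewrite inE => /cards2P[x [y [xy ->]]]; rewrite !inE.
by case/orP=> /eqP->; [exists y|exists x; rewrite setUC].
Qed.

Lemma degree_complete_le v : (degree (complete_graph T) v <= #|T|)%N.
Proof.
apply: (@leq_trans #|[set [set v; w] | w : T]|); last exact: leq_imset_card.
apply/subset_leq_card/subsetP => e.
rewrite in_set => /andP[eK ve]; have [w ->] := edgeP eK ve.
exact: imset_f.
Qed.

Lemma min_degree_le G v : (min_degree G <= degree G v)%N.
Proof.
rewrite /min_degree; have: v \in index_enum T by rewrite mem_index_enum.
elim: (index_enum T) => // w r IHr; rewrite inE big_cons.
by case/orP=> [/eqP<-|/IHr]; [exact: geq_minl|apply: leq_trans (geq_minr _ _)].
Qed.

End Degrees.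

(** * Pulling graphs on the larger board back to [K_n] *)

Section RestrictGraph.
Variables (n : nat) (T : finType) (phi : 'I_n -> T).
Hypothesis phi_inj : injective phi.
Implicit Types G : {set {set T}}.

Lemma restrict_graph_sub G : restrict_graph phi G \subset complete_graph 'I_n.
Proof. by apply/subsetP => e; rewrite !inE => /andP[]. Qed.

Lemma restrict_graphS G G' :
  G \subset G' -> restrict_graph phi G \subset restrict_graph phi G'.
Proof.
by move=> /subsetP sub; apply/subsetP => e; rewrite !inE => /andP[-> /sub->].
Qed.

Lemma card_restrict_graph_le G : (#|restrict_graph phi G| <= #|G|)%N.
Proof.
rewrite -(card_imset _ (imset_inj phi_inj)).
apply/subset_leq_card/subsetP => _ /imsetP[e + ->].
by rewrite inE => /andP[].
Qed.

End RestrictGraph.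

(** * Conditional probabilities in a partially exposed random graph *)

Section Exposure.
Variables (R : realType) (n : nat) (p : R).
Local Notation K := (complete_graph 'I_n).
Implicit Types (G E : {set {set 'I_n}}) (A : pred {set {set 'I_n}}).

(** For disjoint [E1] and [E0], the probability of [A] in G(n, p) given that the pairs in [E1] are
    edges and those in [E0] are not; only unexposed pairs carry weight. *)
Definition cond_prob A E1 E0 : R :=
  \sum_(G : {set {set 'I_n}} | [&& E1 \subset G, G \subset K :\: E0 & A G])
    p ^+ #|G :\: E1| * (1 - p) ^+ #|K :\: E0 :\: G|.

Lemma cond_prob0 A : cond_prob A set0 set0 = Gnp_prob p A.
Proof.
rewrite /cond_prob /Gnp_prob.
apply: eq_big => [G|G _]; first by rewrite sub0set setD0.
by rewrite !setD0.
Qed.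

Lemma completion_exposed G E1 E0 : K \subset E1 :|: E0 ->
  E1 \subset G -> G \subset K :\: E0 -> G = E1.
Proof.
move=> sub E1G GE0; apply/eqP; rewrite eqEsubset E1G andbT.
apply/subsetP => e /(subsetP GE0); rewrite in_setD => /andP[eE0 eK].
by move: (subsetP sub _ eK); rewrite in_setU (negbTE eE0) orbF.
Qed.

Lemma cond_prob_gt0 A E1 E0 :
  K \subset E1 :|: E0 -> 0 < cond_prob A E1 E0 -> A E1.
Proof.
move=> sub; apply: contraTT => nA; rewrite /cond_prob big_pred0 ?ltxx // => G.
apply/negbTE/negP => /and3P[E1G GE0]; apply/negP.
by rewrite (completion_exposed sub E1G GE0).
Qed.

(** Law of total probability: the completions are split by whether they contain [e]. *)
Lemma cond_probD1 A E1 E0 e : e \in K -> e \notin E1 -> e \notin E0 ->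
  cond_prob A E1 E0 =
    p * cond_prob A (e |: E1) E0 + (1 - p) * cond_prob A E1 (e |: E0).
Proof.
move=> eK eE1 eE0; rewrite /cond_prob (bigID (fun G => e \in G)) /=.
congr (_ + _); rewrite big_distrr /=; apply: eq_big.
- move=> G; rewrite subUset sub1set.
  by case: (e \in G); rewrite ?andbT ?andbF.
- move=> G /andP[_ eG]; rewrite mulrA -exprS.
  rewrite [#|G :\: E1|](cardsD1 e) !inE eG eE1 add1n.
  by congr (_ ^+ _.+1 * _); congr #|pred_of_set _|; apply/setP => x;
    rewrite !inE negb_or andbA.
- move=> G; have -> : (G \subset K :\: (e |: E0)) =
      (G \subset K :\: E0) && (e \notin G).
    apply/subsetP/andP => [H|[/subsetP H eG] x xG].
      split; last by apply/negP => /H; rewrite !inE eqxx.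
      by apply/subsetP => x /H; rewrite !inE negb_or -andbA => /and3P[_ -> ->].
    move: (H x xG); rewrite !inE negb_or => /andP[-> ->]; rewrite !andbT.
    by apply: contraNneq eG => <-.
  by case: (e \in G); rewrite ?andbT ?andbF.
- move=> G /andP[_ eG]; rewrite mulrCA -exprS.
  rewrite [#|K :\: E0 :\: G|](cardsD1 e) !in_setD eG eE0 eK add1n.
  congr (_ * _ ^+ _.+1); congr #|pred_of_set _|; apply/setP => x.
  rewrite !inE negb_or; by case: (x == e); case: (x \in G); case: (x \in E0).
Qed.

(** Induction on the number of unexposed pairs through [cond_probD1]; with none left, [E1] is the
    only possible completion and has weight 1. *)
Lemma cond_prob_le1 A : 0 <= p -> p <= 1 ->
  forall E1 E0, cond_prob A E1 E0 <= 1.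
Proof.
move=> p0 p1 E1 E0.
have [m] := ubnP #|K :\: (E1 :|: E0)|; elim: m E1 E0 => // m IHm E1 E0.
rewrite ltnS => leE.
have [/eqP|[e]] := set_0Vmem (K :\: (E1 :|: E0)).
  rewrite setD_eq0 => sub.
  rewrite /cond_prob big_mkcond (bigD1 E1) //= big1 => [|G GE1]; last first.
    case: ifP => // /and3P[E1G GE0 _].
    by rewrite (completion_exposed sub E1G GE0) eqxx in GE1.
  rewrite addr0; case: ifP => // _; rewrite setDv setDDl setUC.
  by move: sub; rewrite -setD_eq0 => /eqP->; rewrite !cards0 !expr0 mulr1.
rewrite in_setD in_setU negb_or => /andP[/andP[eE1 eE0] eK].
rewrite (cond_probD1 A eK eE1 eE0).
have lt_m E : E = e |: (E1 :|: E0) -> (#|K :\: E| < m)%N.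
  move=> ->; apply: leq_trans leE; apply/proper_card/properP; split.
    by apply: setDS; apply: subsetUr.
  exists e; first by rewrite in_setD in_setU negb_or eE1 eE0.
  by rewrite !inE eqxx.
have /IHm h1 := lt_m ((e |: E1) :|: E0) (esym (setUA _ _ _)).
have /IHm h0 := lt_m (E1 :|: (e |: E0)) (setUCA _ _ _).
have p1' : 0 <= 1 - p by rewrite subr_ge0.
have := ler_wpM2l p0 h1; have := ler_wpM2l p1' h0; lra.
Qed.

End Exposure.

(** * Numerical bounds for exponential moments *)

Section Exponentials.
Variable R : realType.
Implicit Types p a c A x : R.

Lemma expR1_le3 : expR 1 <= 3 :> R.
Proof.
(* Inverting [1 - 1/6 <= expR (- 1/6)]; the sixth power of [6/5] is just below 3. *)
have e56 : expR (6^-1) <= 6 / 5 :> R.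
  have := expR_ge1Dx (- 6^-1 : R); rewrite expRN => h.
  rewrite -[expR _]invrK -[6 / 5]invrK lef_pV2 ?posrE ?invr_gt0 ?expR_gt0 //;
    lra.
have -> : 1 = 6^-1 * 6%:R :> R by lra.
rewrite expRM_natr.
apply: (@le_trans _ _ ((6 / 5) ^+ 6)); last lra.
by rewrite lerXn2r // nnegrE ?expR_ge0 //; lra.
Qed.

Lemma expR_up_step p : 0 <= p -> 1 - p + p * expR 1 <= expR (2 * p).
Proof.
move=> p0; apply: le_trans (expR_ge1Dx (2 * p)).
have := ler_wpM2l p0 expR1_le3; lra.
Qed.

Lemma expR_down_step p :
  0 <= p -> 1 - p + p * expR (- 20^-1) <= expR (- (21^-1 * p)).
Proof.
move=> p0; apply: le_trans (expR_ge1Dx _).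
have e20 : expR (- 20^-1) <= 20 / 21 :> R.
  have h := expR_ge1Dx (20^-1 : R).
  rewrite expRN -[20 / 21]invrK lef_pV2 ?posrE ?expR_gt0 //; lra.
have := ler_wpM2l p0 e20; lra.
Qed.

(** [A] is an exponent at a vertex and [i] tells whether the exposed pair contains it. An edge
    shifts the exponent by [a]; the allowance [c] reserved for the pair is used up in both outcomes
    and covers the exponential moment of the toss. *)
Lemma expR_step p a c A (i : bool) : 1 - p + p * expR a <= expR c ->
  p * expR (A + i%:R * a - i%:R * c) + (1 - p) * expR (A - i%:R * c)
    <= expR A.
Proof.
case: i => h; rewrite ?mul0r ?mul1r ?subr0 ?addr0; last lra.
have -> : A + a - c = A - c + a by lra.
rewrite expRD [expR (A - c)]expRD expRN.
have -> : p * (expR A / expR c * expR a) + (1 - p) * (expR A / expR c) =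
  expR A * ((1 - p + p * expR a) / expR c) by ring.
rewrite ger_pMr ?expR_gt0 // ler_pdivrMr ?expR_gt0 // mul1r //.
Qed.

End Exponentials.

(** * The potential and its derandomisation *)

Section Potential.
Variables (R : realType) (n : nat) (p eps : R) (A : pred {set {set 'I_n}}).
Hypothesis p_ge0 : 0 <= p.
Local Notation K := (complete_graph 'I_n).
Implicit Types (E X : {set {set 'I_n}}) (v : 'I_n).

(** The three exponents share one shape: a scaled deviation from a threshold plus a signed allowance
    for each pair at [v] that may still contribute. Here these are the pairs that may still be lost,
    [5/4 eps n] in all, at [2 p] each. *)
Definition failure_exponent E1 X v : R :=
  (degree (E1 :&: X) v)%:R - 18 / 5 * (eps * n%:R * p)
  + 2 * p * (5 / 4 * (eps * n%:R) - (degree X v)%:R).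

Definition upper_exponent E1 E0 v : R :=
  (degree E1 v)%:R - 3 * (n%:R * p)
  + 2 * p * (degree (K :\: (E1 :|: E0)) v)%:R.

Definition lower_exponent E1 E0 v : R :=
  20^-1 * (9 / 10 * (n%:R * p) - (degree E1 v)%:R)
  - 21^-1 * p * (degree (K :\: (E1 :|: E0)) v)%:R.

(* Conditional probability that the graph with exposed edges [E1] and exposed
   non-edges [E0] ends up outside [A], plus exponential-moment bounds for the
   events that too many edges at [v] are lost (those of [E1 :&: X]) and that
   the degree of [v] is not within [9/10 np, 3 np]. *)
Definition potential E1 E0 X : R :=
  1 - cond_prob p A E1 E0 +
  \sum_v (expR (failure_exponent E1 X v) + expR (upper_exponent E1 E0 v)
          + expR (lower_exponent E1 E0 v)).

(** Whether [e] is lost is settled before its coin toss, so [X'] is the same in both outcomes. Each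
    exponential then obeys [expR_step], and the probability term splits by [cond_probD1]. *)
Lemma potential_step E1 E0 X X' e (lost : bool) :
  e \in K -> e \notin E1 -> e \notin E0 -> e \notin X ->
  X' = (if lost then e |: X else X) ->
  p * potential (e |: E1) E0 X' + (1 - p) * potential E1 (e |: E0) X'
    <= potential E1 E0 X.
Proof.
move=> eK eE1 eE0 eX X'E; rewrite /potential (cond_probD1 p A eK eE1 eE0).
set c1 := cond_prob _ _ _ _; set c0 := cond_prob _ _ _ _.
have -> (x y : R) : p * (1 - c1 + x) + (1 - p) * (1 - c0 + y) =
  1 - (p * c1 + (1 - p) * c0) + (p * x + (1 - p) * y) by ring.
rewrite lerD2l !mulr_sumr -big_split /=; apply: ler_sum => v _.
have eE : e \notin E1 :|: E0 by rewrite in_setU negb_or eE1.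
have rem : degree (K :\: (E1 :|: E0)) v =
    ((v \in e) + degree (K :\: (e |: (E1 :|: E0))) v)%N by exact: degreeD1.
have fail : p * expR (failure_exponent (e |: E1) X' v)
    + (1 - p) * expR (failure_exponent E1 X' v)
    <= expR (failure_exponent E1 X v).
  rewrite /failure_exponent X'E; case: (lost); last first.
    have -> : (e |: E1) :&: X = E1 :&: X.
      apply/setP => x; rewrite !inE; case: eqP => // ->.
      by rewrite (negbTE eX) !andbF.
    by rewrite -mulrDl addrC subrK mul1r.
  have -> : (e |: E1) :&: (e |: X) = e |: (E1 :&: X) by rewrite -setUIr.
  have -> : E1 :&: (e |: X) = E1 :&: X.
    apply/setP => x; rewrite !inE; case: eqP => // ->.
    by rewrite (negbTE eE1).
  rewrite !degreeU1 ?inE ?(negbTE eX) ?andbF // !natrD.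
  have := @expR_step R p 1 (2 * p) (failure_exponent E1 X v) (v \in e)
    (expR_up_step p_ge0).
  congr (_ * expR _ + _ * expR _ <= _); rewrite /failure_exponent; ring.
have up : p * expR (upper_exponent (e |: E1) E0 v)
    + (1 - p) * expR (upper_exponent E1 (e |: E0) v)
    <= expR (upper_exponent E1 E0 v).
  have := @expR_step R p 1 (2 * p) (upper_exponent E1 E0 v) (v \in e)
    (expR_up_step p_ge0).
  rewrite /upper_exponent -setUA [E1 :|: (e |: E0)]setUCA degreeU1 // rem !natrD.
  by congr (_ * expR _ + _ * expR _ <= expR _); ring.
have low : p * expR (lower_exponent (e |: E1) E0 v)
    + (1 - p) * expR (lower_exponent E1 (e |: E0) v)
    <= expR (lower_exponent E1 E0 v).
  have := @expR_step R p (- 20^-1) (- (21^-1 * p)) (lower_exponent E1 E0 v)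
    (v \in e) (expR_down_step p_ge0).
  rewrite /lower_exponent -setUA [E1 :|: (e |: E0)]setUCA degreeU1 // rem !natrD.
  by congr (_ * expR _ + _ * expR _ <= expR _); field.
lra.
Qed.

(** A weighted average of the two outcomes is below 1, so one of them is. *)
Lemma potential_choice E1 E0 X X' e (lost : bool) : p <= 1 ->
  e \in K -> e \notin E1 -> e \notin E0 -> e \notin X ->
  potential E1 E0 X < 1 ->
  X' = (if lost then e |: X else X) ->
  potential (e |: E1) E0 X' < 1 \/ potential E1 (e |: E0) X' < 1.
Proof.
move=> p1 eK eE1 eE0 eX pot1 X'E.
have step := potential_step eK eE1 eE0 eX X'E.
have [|h1] := ltP (potential (e |: E1) E0 X') 1; first by left.
have [|h0] := ltP (potential E1 (e |: E0) X') 1; first by right.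
have p1' : 0 <= 1 - p by lra.
have := ler_wpM2l p_ge0 h1; have := ler_wpM2l p1' h0; lra.
Qed.

Lemma potential_lt1 E1 E0 X v : p <= 1 ->
  potential E1 E0 X < 1 ->
  [/\ failure_exponent E1 X v < 0, upper_exponent E1 E0 v < 0
    & lower_exponent E1 E0 v < 0].
Proof.
move=> p1; have := cond_prob_le1 A p_ge0 p1 E1 E0.
rewrite /potential => c1; rewrite (bigD1 v) //=.
set S := \sum_(_ | _) _ => h.
have S0 : 0 <= S by apply: sumr_ge0 => w _; rewrite !addr_ge0 ?expR_ge0.
have h1 := expR_ge0 (failure_exponent E1 X v).
have h2 := expR_ge0 (upper_exponent E1 E0 v).
have h3 := expR_ge0 (lower_exponent E1 E0 v).
split; rewrite -expR_lt1; lra.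
Qed.

Lemma potential_lt1_prob E1 E0 X :
  potential E1 E0 X < 1 -> 0 < cond_prob p A E1 E0.
Proof.
rewrite /potential; set S := \sum_v _ => h.
suff S0 : 0 <= S by lra.
by apply: sumr_ge0 => w _; rewrite !addr_ge0 ?expR_ge0.
Qed.

End Potential.

(** * The box game *)

Section BoxGame.
Variables (R : realType) (I : finType) (N beta : R).
Implicit Types (act S : {set I}) (w : I -> R).

(** Any [k] boxes weigh together at most [beta k ln (N / k)] plus [slack], which stands for the
    weight that Breaker may have added since the last selection. *)
Definition box_bound (slack : R) act w :=
  forall S, S \subset act -> S != set0 ->
    \sum_(v in S) w v <= beta * #|S|%:R * (ln N - ln #|S|%:R) + slack.

Lemma box_bound_le slack slack' act w :
  slack <= slack' -> box_bound slack act w -> box_bound slack' act w.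
Proof.
by move=> le h S SA S0; apply: le_trans (h S SA S0) _; rewrite lerD2l.
Qed.

Lemma box_bound_sub slack act act' w :
  act' \subset act -> box_bound slack act w -> box_bound slack act' w.
Proof. by move=> sub h S SA S0; apply: h S0; apply: subset_trans sub. Qed.

Lemma box_bound_add slack delta act w w' :
  (forall S, \sum_(v in S) w' v <= \sum_(v in S) w v + delta) ->
  box_bound slack act w -> box_bound (slack + delta) act w'.
Proof.
move=> le h S SA S0; apply: le_trans (le S) _; rewrite addrA lerD2r.
exact: h.
Qed.

Lemma box_bound1 slack act w v :
  v \in act -> box_bound slack act w -> w v <= beta * ln N + slack.
Proof.
move=> va /(_ [set v]); rewrite sub1set => /(_ va).
rewrite big_set1 cards1 ln1 subr0 mulr1; apply.
by apply/set0Pn; exists v; rewrite set11.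
Qed.

(** This is [ln (1 + x) <= x] at [x = - 1 / (k + 1)]. *)
Lemma invSn_le_ln (k : nat) :
  (0 < k)%N -> (k.+1%:R)^-1 <= ln (k.+1%:R) - ln k%:R :> R.
Proof.
move=> k0.
have kR : 0 < k%:R :> R by rewrite ltr0n.
have kS : 0 < k.+1%:R :> R by rewrite ltr0n.
rewrite -[X in X <= _]opprK -[X in _ <= X]opprB lerN2 -ln_div ?posrE //.
have -> : k%:R / k.+1%:R = 1 + - (k.+1%:R)^-1 :> R.
  by rewrite -natr1; field; rewrite natr1 gt_eqF.
apply: le_ln1Dx; rewrite ltrN2 invf_lt1 //.
by rewrite ltr1n ltnS.
Qed.

(* If the largest box [u] is not in [S], averaging over [u |: S] shows that
   [S] satisfies the bound without slack, since [ln k + 1 / (k + 1) <=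
   ln (k + 1)]. *)
Lemma box_bound_select act w : 0 <= beta -> act != set0 ->
  box_bound beta act w ->
  exists2 u, u \in act &
    box_bound 0 act (fun v => w v - beta * (v == u)%:R).
Proof.
move=> beta0 /set0Pn[u0 u0a] h.
have [u ua umax] : exists2 u, u \in act & forall v, v \in act -> w v <= w u.
  have [u ua umax] := @arg_maxP _ R I u0 (mem act) w u0a.
  by exists u.
exists u => // S SA S0; rewrite big_split /= sumrN -mulr_sumr addr0.
have k0 : (0 < #|S|)%N by rewrite card_gt0.
(* For [S] containing [u], the [beta] taken off [u] cancels the slack. *)
have [uS|uS] := boolP (u \in S).
  have -> : \sum_(v in S) (v == u)%:R = 1 :> R.
    rewrite (bigD1 u) //= eqxx big1 ?addr0 // => v /andP[_ /negbTE->] //.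
  by have := h S SA S0; lra.
have -> : \sum_(v in S) (v == u)%:R = 0 :> R.
  by rewrite big1 // => v vS; case: eqP => // vu; rewrite -vu vS in uS.
rewrite mulr0 subr0.
have USA : u |: S \subset act by rewrite subUset sub1set ua.
have US0 : u |: S != set0 by apply/set0Pn; exists u; rewrite setU11.
have := h _ USA US0; rewrite big_setU1 //= cardsU1 uS add1n.
set s := \sum_(v in S) w v.
have sle : s <= #|S|%:R * w u.
  rewrite mulr_natl -sumr_const; apply: ler_sum => v vS.
  exact: umax (subsetP SA v vS).
have := invSn_le_ln k0.
move: k0 sle; move: #|S| => k k0 sle lnk hk.
have kR : 0 < k%:R :> R by rewrite ltr0n.
have kS : 0 < k.+1%:R :> R by rewrite ltr0n.
have hs : k.+1%:R * s <= k%:R * (w u + s).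
  by rewrite -natr1 mulrDl mul1r mulrDr addrC lerD2r.
rewrite -(ler_pM2l kS); apply: le_trans hs _.
apply: le_trans (ler_wpM2l (ltW kR) hk) _.
have -> : k%:R * (beta * k.+1%:R * (ln N - ln k.+1%:R) + beta) =
  k.+1%:R * (beta * k%:R * (ln N - ln k.+1%:R + (k.+1%:R)^-1)).
  by field; rewrite gt_eqF.
rewrite ler_pM2l // ler_wpM2l ?mulr_ge0 ?ler0n //.
by rewrite -addrA lerD2l addrC lerBlDr [- _ + _]addrC.
Qed.

End BoxGame.

(** * Walker's invariant and how selections, replies and exposures preserve it *)

Section Invariant.
Variables (R : realType) (n : nat) (p eps b beta : R).
Variable A : pred {set {set 'I_n}}.
Variables (T : finType) (board : {set {set T}}) (phi : 'I_n -> T).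
Variables W0 B0 : {set {set T}}.
Local Notation K := (complete_graph 'I_n).
Local Notation restr := (restrict_graph phi).
Local Notation F0 := (restr (board :\: (W0 :|: B0))).

Hypotheses (p_ge0 : 0 <= p) (p_le1 : p <= 1) (beta_ge0 : 0 <= beta).
Hypothesis phi_inj : injective phi.
Hypothesis restr_board : restr board = K.
Hypothesis F0_deg : forall v, (degree (K :\: F0) v)%:R <= eps * n%:R.
Hypothesis budget : eps * n%:R + beta * (3 * (n%:R * p) + ln n%:R + 2)
  <= 5 / 4 * (eps * n%:R).

Implicit Types (W B S : {set {set T}}) (E X : {set {set 'I_n}}).
Implicit Types (c q : 'I_n -> nat).

Definition unexposed E1 E0 := K :\: (E1 :|: E0).

Definition active E1 E0 := [set v | (0 < degree (unexposed E1 E0) v)%N].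

Definition danger B c (v : 'I_n) : R :=
  (degree (restr (B :\: B0)) v)%:R - beta * (c v)%:R.

(* [W] and [B] are the edges owned by Walker and Breaker; [X] is the set of
   exposed edges that were not free at the time of their exposure; [c v] counts
   how often [v] was selected, and exceeds the number of exposed edges at [v]
   by at most [q v]. *)
Record walker_invariant W B E1 E0 X c q (slack : R) : Prop := Invariant {
  inv_legal : W \subset board :\: B;
  inv_start : W0 \subset W;
  inv_new : restr W \subset restr W0 :|: E1;
  inv_claimed : E1 :\: X \subset restr (W :\: W0);
  inv_exposed : X \subset E1 :|: E0;
  inv_lost : X \subset (K :\: F0) :|: restr (B :\: B0);
  inv_potential : potential p eps A E1 E0 X < 1;
  inv_degree : forall v, (degree X v)%:R <= 5 / 4 * (eps * n%:R);
  inv_box : box_bound n%:R beta slack (active E1 E0) (danger B c);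
  inv_count : forall v, v \in active E1 E0 -> (c v <= degree E1 v + q v)%N }.

Lemma active_edge E1 E0 e v :
  e \in unexposed E1 E0 -> v \in e -> v \in active E1 E0.
Proof.
by move=> eU ve; rewrite inE card_gt0; apply/set0Pn; exists e; rewrite in_set eU.
Qed.

Lemma activeP E1 E0 v : v \in active E1 E0 ->
  exists2 e, e \in unexposed E1 E0 & v \in e.
Proof.
by rewrite inE card_gt0 => /set0Pn[e]; rewrite in_set => /andP[]; exists e.
Qed.

Lemma unexposed_active0 E1 E0 : active E1 E0 = set0 -> K \subset E1 :|: E0.
Proof.
move=> act0; rewrite -setD_eq0; apply/eqP/setP => e; rewrite in_set0.
apply/negbTE/negP => eU.
have /card_gt0P[v ve] : (0 < #|e|)%N.
  by move: eU; rewrite in_setD => /andP[_]; rewrite inE => /eqP->.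
by have := active_edge eU ve; rewrite act0 inE.
Qed.

Lemma activeS E1 E0 E1' E0' : E1 :|: E0 \subset E1' :|: E0' ->
  active E1' E0' \subset active E1 E0.
Proof.
move=> sub; apply/subsetP => v; rewrite !inE => /leq_trans; apply.
by apply: degreeS; apply: setDS.
Qed.

Lemma card_unexposed E1 E0 E1' E0' e : e \in unexposed E1 E0 ->
  E1' :|: E0' = e |: (E1 :|: E0) ->
  (#|unexposed E1' E0'| < #|unexposed E1 E0|)%N.
Proof.
move=> eU EE'; apply/proper_card/properP; rewrite /unexposed EE'; split.
  by apply: setDS; apply: subsetUr.
by exists e => //; rewrite in_setD setU11.
Qed.

Lemma invariant_weaken W B E1 E0 X c q q' slack slack' :
  slack <= slack' ->
  (forall v, v \in active E1 E0 -> (c v <= degree E1 v + q' v)%N) ->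
  walker_invariant W B E1 E0 X c q slack -> walker_invariant W B E1 E0 X c q' slack'.
Proof. by move=> le q'P []; split=> //; apply: box_bound_le le _. Qed.

(** The selection removes the whole slack [beta]. In exchange [c u] grows before a new edge at [u]
    is exposed, which [q u = 1] records. *)
Lemma invariant_select W B E1 E0 X c :
  active E1 E0 != set0 -> walker_invariant W B E1 E0 X c (fun=> 0%N) beta ->
  exists2 u, u \in active E1 E0 &
    walker_invariant W B E1 E0 X (fun v => c v + (v == u))%N (fun v => v == u : nat) 0.
Proof.
move=> act0 [? ? ? ? ? ? ? ? box cnt].
have [u ua ubox] := box_bound_select beta_ge0 act0 box.
exists u => //; split=> //; last first.
  by move=> v va; rewrite leq_add2r -[degree _ _]addn0 cnt.
move=> S SA S0; have := ubox S SA S0.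
congr (_ <= _); apply: eq_bigr => v _.
by rewrite /danger natrD mulrDr opprD addrA.
Qed.

(** Each of Breaker's at most [b] edges raises the danger of at most two vertices by 1, hence any
    total by at most [2 b]. *)
Lemma invariant_reply W B E1 E0 X c q slack S :
  S \subset board :\: (W :|: B) -> #|S|%:R <= b ->
  walker_invariant W B E1 E0 X c q slack ->
  walker_invariant W (S :|: B) E1 E0 X c q (slack + 2 * b).
Proof.
move=> Sfree Sb [legal ? ? ? ? lost ? ? box ?]; split=> //.
- apply/subsetP => e eW; have := subsetP legal _ eW.
  rewrite !inE negb_or => /andP[-> ->]; rewrite !andbT.
  by apply/negP => /(subsetP Sfree); rewrite !inE eW.
- apply: subset_trans lost _; apply: setUS; apply: restrict_graphS.
  by apply: setSD; apply: subsetUr.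
apply: box_bound_add box => V.
have degS v : (degree (restr ((S :|: B) :\: B0)) v <=
    degree (restr (B :\: B0)) v + degree (restr S) v)%N.
  apply: leq_trans (degreeU_le _ _ _); apply: degreeS.
  apply/subsetP => e; rewrite !inE.
  by case: (#|e| == 2%N); case: (phi @: e \in S); case: (phi @: e \in B);
    case: (phi @: e \in B0).
have sumS : (\sum_(v in V) degree (restr S) v)%:R <= 2 * b.
  apply: (@le_trans _ _ (2 * #|S|%:R)); last by rewrite ler_pM2l.
  rewrite -natrM ler_nat.
  apply: leq_trans (sum_degree_le V (restrict_graph_sub _ _)) _.
  by rewrite leq_mul2l card_restrict_graph_le ?orbT.
apply: le_trans (lerD (lexx _) sumS).
rewrite natr_sum -big_split /=; apply: ler_sum => v _; rewrite /danger.
have := degS v; rewrite -(ler_nat R) natrD; lra.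
Qed.

(** The terms of [budget]: at most [eps n] pairs are not free from the start; [v] was selected at
    most [3 n p + 1] times, since [upper_exponent] is negative; the box bound for a singleton adds
    [ln n], and the slack of at most [beta] adds 1. *)
Lemma lost_degree W B E1 E0 X c q slack v :
  slack <= beta -> (q v <= 1)%N ->
  walker_invariant W B E1 E0 X c q slack -> v \in active E1 E0 ->
  (degree ((K :\: F0) :|: restr (B :\: B0)) v)%:R <= 5 / 4 * (eps * n%:R).
Proof.
move=> sb q1 [? ? ? ? ? ? pot ? box cnt] va.
apply: le_trans budget.
have := degreeU_le (K :\: F0) (restr (B :\: B0)) v.
rewrite -(ler_nat R) natrD => /le_trans; apply; apply: lerD; first exact: F0_deg.
have := box_bound1 va box; rewrite /danger.
have [_ up _] := potential_lt1 p_ge0 v p_le1 pot.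
have cD : (c v)%:R <= (degree E1 v)%:R + 1 :> R.
  have := leq_trans (cnt v va) (leq_add (leqnn _) q1).
  by rewrite -(ler_nat R) natrD.
have D3 : (degree E1 v)%:R <= 3 * (n%:R * p).
  have r0 : 0 <= 2 * p * (degree (K :\: (E1 :|: E0)) v)%:R.
    by rewrite !mulr_ge0.
  by move: up; rewrite /upper_exponent; lra.
have bc : beta * (c v)%:R <= beta * (3 * (n%:R * p) + 1).
  by apply: ler_wpM2l => //; lra.
rewrite !mulrDr !mulr1 in bc *; lra.
Qed.

(** Treats all outcomes of exposing [e] at once. *)
Lemma invariant_expose_aux W W' B E1 E1' E0 E0' X X' c q slack e :
  slack <= beta -> (forall v, q v <= 1)%N ->
  e \in unexposed E1 E0 ->
  E1 \subset E1' -> E1' :|: E0' = e |: (E1 :|: E0) ->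
  X' = X \/ X' = e |: X /\ phi @: e \notin board :\: (W :|: B) ->
  W' \subset board :\: B -> W \subset W' ->
  restr W' \subset restr W0 :|: E1' -> E1' :\: X' \subset restr (W' :\: W0) ->
  potential p eps A E1' E0' X' < 1 ->
  walker_invariant W B E1 E0 X c q slack -> walker_invariant W' B E1' E0' X' c q slack.
Proof.
move=> sb q1 eU E1E1' EE' XX' W'leg WW' W'new W'cl pot' inv.
have [legal start new cl Xexp lost pot degX box cnt] := inv.
have [eE eK] : e \notin E1 :|: E0 /\ e \in K.
  by move: eU; rewrite in_setD => /andP[].
have act' : active E1' E0' \subset active E1 E0.
  by apply: activeS; rewrite EE'; apply: subsetUr.
(* A pair that is not free belongs to Breaker or to Walker; an unexposed pair of Walker lies in
   [W0], so it was not free at the start. *)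
have lost' : X' \subset (K :\: F0) :|: restr (B :\: B0).
  case: XX' => [-> //|[-> nfree]]; rewrite subUset sub1set lost andbT.
  have eb : phi @: e \in board.
    by move: eK; rewrite -restr_board inE => /andP[].
  move: nfree; rewrite in_setD eb andbT negbK in_setU.
  case/orP=> [eW|eB].
    have: e \in restr W by rewrite inE eK.
    move/(subsetP new); rewrite in_setU => /orP[eW0|eE1].
      move: eW0; rewrite inE => /andP[_ eW0].
      by rewrite in_setU in_setD eK andbT [e \in restr _]inE !inE eW0 /= andbF.
    by rewrite in_setU eE1 in eE.
  rewrite in_setU in_setD eK andbT ![e \in restr _]inE eK /= !in_setD eB eb.
  by rewrite in_setU; case: (phi @: e \in B0); rewrite ?orbT.
split=> //.
- exact: subset_trans start WW'.
- rewrite EE'; case: XX' => [->|[-> _]].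
    by apply: subset_trans Xexp _; apply: subsetUr.
  exact: setUS.
(* An end of [e] is active, so [lost_degree] applies; elsewhere the degree does not change. *)
- move=> v; case: XX' => [-> //|[X'E nfree]].
  have [ve|ve] := boolP (v \in e).
    apply: le_trans (lost_degree sb (q1 v) inv (active_edge eU ve)).
    by rewrite ler_nat degreeS.
  rewrite X'E degreeU1 ?(negbTE ve) ?add0n //.
  by apply: contra eE => /(subsetP Xexp).
- exact: box_bound_sub act' box.
- move=> v /(subsetP act') va; apply: leq_trans (cnt v va) _.
  by rewrite leq_add2r degreeS.
Qed.

(** The coin toss is fixed by [potential_choice]. A non-edge or a lost edge leaves Walker's graph as
    it is, so no move of the game is made; only a free edge is walked. *)
Lemma invariant_expose W B E1 E0 X c q slack e :
  slack <= beta -> (forall v, q v <= 1)%N ->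
  e \in unexposed E1 E0 -> walker_invariant W B E1 E0 X c q slack ->
  (exists X', walker_invariant W B E1 (e |: E0) X' c q slack) \/
  (exists X', walker_invariant W B (e |: E1) E0 X' c q slack) \/
  [/\ phi @: e \in board :\: (W :|: B) &
      walker_invariant (phi @: e |: W) B (e |: E1) E0 X c q slack].
Proof.
move=> sb q1 eU inv.
have [legal start new cl Xexp lost pot degX box cnt] := inv.
have /andP[eE eK] : (e \notin E1 :|: E0) && (e \in K) by rewrite -in_setD.
have /andP[eE1 eE0] : (e \notin E1) && (e \notin E0).
  by rewrite -negb_or -in_setU.
have eX : e \notin X by apply: contra eE => /(subsetP Xexp).
pose free := phi @: e \in board :\: (W :|: B).
pose X' := if ~~ free then e |: X else X.
have XX' : X' = X \/ X' = e |: X /\ phi @: e \notin board :\: (W :|: B).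
  by rewrite /X'; have [fr|nfr] := boolP free; [left|right].
have XsubX' : X \subset X' by rewrite /X'; case: ifP => _ //; apply: subsetUr.
have ED : E1 :\: X' \subset restr (W :\: W0).
  by apply: subset_trans cl; apply: setDS.
have [pot1|pot0] := potential_choice p_ge0 p_le1 eK eE1 eE0 eX pot
  (erefl X'); last first.
  left; exists X'; apply: (invariant_expose_aux sb q1 eU) inv => //.
  by rewrite setUCA.
right; have [fr|nfr] := boolP free; last first.
  left; exists X'; apply: (invariant_expose_aux sb q1 eU) inv => //.
  - exact: subsetUr.
  - by rewrite setUA.
  - by apply: subset_trans new _; apply: setUS; apply: subsetUr.
  - apply: subset_trans cl; apply/subsetP => e'; rewrite /X' nfr !inE negb_or.
    by case/andP=> /andP[/negbTE-> ->].
have X'E : X' = X by rewrite /X' fr.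
right; split=> //; rewrite X'E in pot1.
apply: (invariant_expose_aux sb q1 eU) inv => //.
- exact: subsetUr.
- by rewrite setUA.
- by left.
- rewrite subUset sub1set legal andbT.
  by move: fr; rewrite /free !in_setD in_setU negb_or => /andP[/andP[_ ->] ->].
- exact: subsetUr.
- apply/subsetP => e'; rewrite inE in_setU1 => /andP[e'K /orP[/eqP ee'|e'W]].
    by rewrite in_setU (imset_inj phi_inj ee') setU11 orbT.
  have : e' \in restr W by rewrite inE e'K.
  by move/(subsetP new); rewrite !in_setU => /orP[->|->]; rewrite ?orbT.
(* A free pair is outside [W0], so the edge claimed for it counts as new. *)
- apply/subsetP => e'; rewrite in_setD in_setU1 => /andP[e'X /orP[/eqP->|e'E1]].
    rewrite inE eK in_setD setU11 andbT.
    move: fr; rewrite /free in_setD in_setU negb_or => /andP[/andP[nW _] _].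
    by apply: contra nW => /(subsetP start).
  have : e' \in restr (W :\: W0).
    by apply: (subsetP cl); rewrite in_setD e'X.
  apply/subsetP/restrict_graphS/setSD; exact: subsetUr.
Qed.

End Invariant.

(** With all pairs exposed, positive conditional probability means that [E1] itself is robust. The
    lost edges [E1 :&: X] have degrees below [18/5 eps n p], which is [4 eps] times the lower bound
    [9/10 n p] on the degrees of [E1], so they may be deleted; all that remains was claimed by
    Walker. *)
Lemma invariant_done (R : realType) (n : nat) (p eps beta : R) (P : property)
    (T : finType) (board : {set {set T}}) (phi : 'I_n -> T) W0 B0 W B
    E1 E0 X c q slack :
  0 <= p -> p <= 1 -> 0 <= eps -> monotone_increasing P ->
  @walker_invariant R n p eps beta (robustly P (4 * eps) (n := n)) T board phi W0 B0
    W B E1 E0 X c q slack ->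
  active E1 E0 = set0 -> P n (restrict_graph phi (W :\: W0)).
Proof.
move=> p0 p1 eps0 Pmono [legal start new cl Xexp lost pot degX box cnt] act0.
have sub := unexposed_active0 act0.
have := cond_prob_gt0 sub (potential_lt1_prob pot).
move/forallP/(_ (E1 :&: X)); rewrite subsetIl /= => rob.
have PEX : P n (E1 :\: X).
  have -> : E1 :\: X = E1 :\: (E1 :&: X).
    by apply/setP => e; rewrite !inE; case: (e \in E1); rewrite ?andbF ?andbT.
  apply: (implyP rob); apply/forallP => v.
  have [fail _ low] := potential_lt1 p0 v p1 pot.
  have rem0 : degree (complete_graph 'I_n :\: (E1 :|: E0)) v = 0%N.
    by move: sub; rewrite -setD_eq0 => /eqP->; rewrite degree0.
  move: fail low; rewrite /failure_exponent /lower_exponent rem0 mulr0 subr0.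
  have k0 : 0 <= 2 * p * (5 / 4 * (eps * n%:R) - (degree X v)%:R).
    by rewrite mulr_ge0 ?mulr_ge0 // subr_ge0.
  move=> fail low.
  have D9 : 9 / 10 * (n%:R * p) <= (degree E1 v)%:R by lra.
  have := ler_wpM2l eps0 D9; lra.
apply: Pmono PEX => //; exact: restrict_graph_sub.
Qed.

(** * Walker's strategy as a recursion on the unexposed pairs *)

Section Strategy.
Variables (R : realType) (n : nat) (p eps b beta : R) (P : property) (d : nat).
Variables (T : finType) (board : {set {set T}}) (phi : 'I_n -> T).
Variables W0 B0 : {set {set T}}.
Local Notation K := (complete_graph 'I_n).
Local Notation restr := (restrict_graph phi).
Local Notation F0 := (restr (board :\: (W0 :|: B0))).

Hypotheses (p_ge0 : 0 <= p) (p_le1 : p <= 1) (eps_ge0 : 0 <= eps).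
Hypotheses (b_ge0 : 0 <= b) (betaE : beta = 2 * b * d.+1%:R).
Hypothesis P_mono : monotone_increasing P.
Hypothesis phi_inj : injective phi.
Hypothesis restr_board : restr board = K.
Hypothesis F0_deg : forall v, (degree (K :\: F0) v)%:R <= eps * n%:R.
Hypothesis budget : eps * n%:R + beta * (3 * (n%:R * p) + ln n%:R + 2)
  <= 5 / 4 * (eps * n%:R).
Hypothesis W0_paths : forall u v, path_within W0 d (phi u) (phi v).

Local Notation inv := (walker_invariant p eps beta (robustly P (4 * eps) (n := n))
  board phi W0 B0).
Local Notation won := (wins board b
  (fun s => @P n (restr (walker_edges s :\: W0)))).

Implicit Types (s : position T) (E X : {set {set 'I_n}}) (c : 'I_n -> nat).

Lemma beta_ge0 : 0 <= beta.
Proof. by rewrite betaE !mulr_ge0. Qed.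

(** [k] counts the steps already walked. Walker's own edges are never blocked and her graph does not
    change, so a step costs just one reply of Breaker, [2 b] of slack. *)
Lemma walk_to s rest (u : 'I_n) k E1 E0 X c q :
  (size rest + k <= d)%N -> walker_to_move s ->
  path (adj W0) (location s) rest -> last (location s) rest = phi u ->
  inv (walker_edges s) (breaker_edges s) E1 E0 X c q (2 * b * k%:R) ->
  (forall s', walker_to_move s' -> location s' = phi u ->
    inv (walker_edges s') (breaker_edges s') E1 E0 X c q (2 * b * d%:R) ->
    won s') ->
  won s.
Proof.
move=> + + + + + H; elim: rest s k => [|w rest IHrest] s k /= kd ms.
  move=> _ lu invs; apply: H => //.
  apply: invariant_weaken (inv_count invs) invs.
  by rewrite ler_wpM2l ?mulr_ge0 // ler_nat.
case/andP=> adjw pathw lastw invs.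
have eW : [set location s; w] |: walker_edges s = walker_edges s.
  apply/setUidPr; rewrite sub1set.
  exact: subsetP (inv_start invs) _ adjw.
apply: (@wins_walk _ _ _ _ _ _ w) => //.
  apply: (subsetP (inv_legal invs)); exact: subsetP (inv_start invs) _ adjw.
apply: wins_reply => // S [Sfree Sb _].
apply: (IHrest _ k.+1) => //=; first by rewrite addnS.
rewrite eW; rewrite /free_edges /= eW in Sfree.
have := invariant_reply phi_inj Sfree Sb invs.
by apply: invariant_weaken (inv_count invs); rewrite -[k.+1]addn1 natrD; lra.
Qed.

Lemma select_wins m s E1 E0 X c y :
  (#|unexposed E1 E0| < m)%N -> walker_to_move s -> location s = phi y ->
  inv (walker_edges s) (breaker_edges s) E1 E0 X c (fun=> 0%N) beta -> won s.
Proof.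
(* Walker is about to select a vertex; slack [beta] has built up. *)
pose sel m := forall s E1 E0 X c y,
  (#|unexposed E1 E0| < m)%N -> walker_to_move s -> location s = phi y ->
  inv (walker_edges s) (breaker_edges s) E1 E0 X c (fun=> 0%N) beta -> won s.
(* Walker stands at the selected vertex [u]; the walk to it has cost at most [2 b d]. *)
pose expo m := forall s E1 E0 X c u,
  (#|unexposed E1 E0| < m)%N -> walker_to_move s -> location s = phi u ->
  inv (walker_edges s) (breaker_edges s) E1 E0 X c (fun v => v == u : nat)
    (2 * b * d%:R) -> won s.
suff [sm _] : sel m /\ expo m by exact: sm.
have bd : 2 * b * d%:R <= beta.
  by rewrite betaE ler_wpM2l ?mulr_ge0 // ler_nat.
have q1 (u v : 'I_n) : ((v == u : nat) <= 1)%N by case: eqP.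
elim: m {s E1 E0 X c y} => [|m [IHsel IHexpo]]; first by split.
(* A selection exposes no pair, so [sel] rests on [expo] for active [u] at the same level. That case
   comes first: it exposes a pair at [u] and needs lower levels only. *)
have expo_active s E1 E0 X c u :
    (#|unexposed E1 E0| < m.+1)%N -> walker_to_move s -> location s = phi u ->
    u \in active E1 E0 ->
    inv (walker_edges s) (breaker_edges s) E1 E0 X c (fun v => v == u : nat)
      (2 * b * d%:R) -> won s.
  rewrite ltnS => leU ms lu /activeP[e eU ue] invs.
  have [eE eK] : e \notin E1 :|: E0 /\ e \in K.
    by move: eU; rewrite in_setD => /andP[].
  have ltU E1' E0' : E1' :|: E0' = e |: (E1 :|: E0) ->
      (#|unexposed E1' E0'| < m)%N.
    by move=> EE'; apply: leq_trans leU; apply: card_unexposed eU EE'.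
  have lt0 : (#|unexposed E1 (e |: E0)| < m)%N by rewrite ltU // setUCA.
  have lt1 : (#|unexposed (e |: E1) E0| < m)%N by rewrite ltU // setUA.
  case: (invariant_expose p_ge0 p_le1 beta_ge0 phi_inj restr_board F0_deg budget
    bd
    (q1 u) eU invs) => [[X' inv']|[[X' inv']|[free inv']]].
  - exact: IHexpo lt0 ms lu inv'.
  - exact: IHexpo lt1 ms lu inv'.
  have [w eE'] := edgeP eK ue.
  have phie : phi @: e = [set location s; phi w].
    by rewrite lu eE' imsetU !imset_set1.
  apply: (@wins_walk _ _ _ _ _ _ (phi w)) => //.
    rewrite /walker_legal -phie.
    by move: free; rewrite !in_setD in_setU negb_or => /andP[/andP[_ ->] ->].
  apply: wins_reply => // S [Sfree Sb _].
  apply: (IHsel _ (e |: E1) E0 X c w) => //=; rewrite -phie.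
  rewrite /free_edges /= -phie in Sfree.
  have := invariant_reply phi_inj Sfree Sb inv'.
  (* The reply completes the slack, [2 b d + 2 b = beta], and the new edge at [u] makes up for the
     visit, so [q] returns to 0. *)
  apply: invariant_weaken; first by rewrite betaE -natr1; lra.
  move=> v va; rewrite addn0 degreeU1; last first.
    by move: eE; rewrite in_setU negb_or => /andP[].
  have va' : v \in active E1 E0.
    by apply: (subsetP (activeS _)) va; rewrite -setUA; apply: subsetUr.
  apply: leq_trans (inv_count invs va') _; rewrite addnC leq_add2r.
  by case: eqP => // ->; rewrite ue.
have sel_next : sel m.+1.
  move=> s E1 E0 X c y leU ms ly invs.
  have [act0|act0] := eqVneq (active E1 E0) set0.
    by apply: wins_goal; apply: invariant_done invs act0.
  have [u ua invu] := invariant_select beta_ge0 act0 invs.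
  have [rest [pathr _ lastr sizer]] := W0_paths y u.
  apply: (@walk_to s rest u 0 E1 E0 X _ _ _ ms); last first.
  - move=> s' ms' lu; exact: (expo_active s' E1 E0 X _ u leU ms' lu ua).
  - by rewrite mulr0; exact: invu.
  - by rewrite ly.
  - by rewrite ly.
  - by rewrite addn0.
split=> // s E1 E0 X c u leU ms lu invs.
have [ua|ua] := boolP (u \in active E1 E0); first exact: expo_active invs.
(* Counts are bounded at active vertices only, so the pending visit to the exhausted [u] can be
   forgotten. *)
apply: (sel_next s E1 E0 X c u) => //; apply: invariant_weaken (invs) => // v va.
have := inv_count invs va; case: eqP => // vu.
by rewrite -vu va in ua.
Qed.

Lemma start_wins s0 (v0 : 'I_n) :
  walker_edges s0 = W0 -> breaker_edges s0 = B0 -> location s0 = phi v0 ->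
  W0 \subset board :\: B0 ->
  potential p eps (robustly P (4 * eps) (n := n)) set0 set0 set0 < 1 ->
  won s0.
Proof.
move=> sW sB lv legal pot.
have en0 : 0 <= eps * n%:R by rewrite mulr_ge0.
have inv0 : inv W0 B0 set0 set0 set0 (fun=> 0%N) (fun=> 0%N) 0.
  split=> //; rewrite ?setU0 ?set0D ?sub0set //.
  - by move=> v; rewrite degree0; lra.
  (* All dangers start at 0, and the right-hand side is nonnegative because [#|S| <= n]. *)
  - move=> S _ S0; rewrite big1 => [|v _]; last first.
      rewrite /danger setDv mulr0 subr0 (_ : restr set0 = set0) ?degree0 //.
      by apply/setP => e; rewrite !inE andbF.
    have S0' : (0 < #|S|)%N by rewrite card_gt0.
    rewrite addr0 !mulr_ge0 ?beta_ge0 // subr_ge0 ler_ln ?posrE ?ltr0n //.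
      by rewrite ler_nat -[X in (_ <= X)%N]card_ord max_card.
    by apply: leq_trans S0' _; rewrite -[X in (_ <= X)%N]card_ord max_card.
have [ms|ms] := boolP (walker_to_move s0).
  apply: (@select_wins _ s0 set0 set0 set0 (fun=> 0%N) v0 (ltnSn _)) => //.
  rewrite sW sB.
  by apply: invariant_weaken (inv_count inv0) inv0; apply: beta_ge0.
(* If Breaker moves first, this reply costs slack [2 b], at most [beta]. *)
apply: wins_reply => // S [Sfree Sb _]; rewrite /free_edges sW sB in Sfree.
apply: (@select_wins _ _ set0 set0 set0 (fun=> 0%N) v0 (ltnSn _)) => //=.
rewrite sW sB; have := invariant_reply phi_inj Sfree Sb inv0.
apply: invariant_weaken (inv_count inv0).
by rewrite add0r betaE ler_peMr ?mulr_ge0 // ler1n.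
Qed.

End Strategy.

(** * Starting value of the potential, and the choice of constants *)

(** Each of the [3 n] exponentials is at most [n^(-11/10)], so their sum is at most
    [3 n^(-1/10) <= 3/7], while the probability term is below [1/2]. *)
Lemma initial_potential (R : realType) (n : nat) (p eps : R)
    (A : pred {set {set 'I_n}}) :
  0 <= p -> 0 < eps -> eps * (10 * 10 * 10) <= 1 ->
  ln n%:R <= eps * (n%:R * p) -> 60 <= ln n%:R :> R ->
  (forall v, (1 - eps) * n%:R <= (degree (complete_graph 'I_n) v)%:R) ->
  1 / 2 < Gnp_prob p A -> potential p eps A set0 set0 set0 < 1.
Proof.
move=> p0 eps0 eps3 Lle L60 degK pA.
have [L LE] : {L : R | L = ln n%:R} by exists (ln n%:R).
have [m mE] : {m : R | m = n%:R * p} by exists (n%:R * p).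
rewrite -LE -?mE in Lle L60.
have nE : n%:R = expR L :> R.
  rewrite LE lnK // posrE ltNge; apply/negP => n0.
  by move: L60; rewrite LE ln0 //; lra.
have m0 : 0 <= m by rewrite mE mulr_ge0.
have mL : 10 * 10 * 10 * L <= m.
  apply: (@le_trans _ _ (10 * 10 * 10 * (eps * m))); first by rewrite ler_wpM2l.
  by rewrite mulrA ler_piMl // mulrC.
rewrite /potential cond_prob0.
set S := \sum_v _.
suff S3 : S <= 3 * expR (- (10^-1 * L)).
  have e7 : 7 <= expR (10^-1 * L).
    by apply: le_trans (expR_ge1Dx _); lra.
  have e7' : expR (- (10^-1 * L)) <= 7^-1.
    by rewrite expRN lef_pV2 ?posrE ?expR_gt0.
  have {S3} S37 : S <= 3 * 7^-1 by apply: le_trans S3 _; rewrite ler_pM2l.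
  move: S (Gnp_prob p A) S37 pA => S g S37 pA; lra.
have -> : 3 * expR (- (10^-1 * L)) =
    \sum_(v : 'I_n) 3 * expR (- (11 / 10 * L)).
  rewrite sumr_const card_ord -[in RHS](mulr_natl _ n) nE mulrCA -expRD.
  by congr (_ * expR _); lra.
rewrite /S {S}; apply: ler_sum => v _; rewrite [3 * _](_ : _ = expR (- (11 / 10 * L))
  + expR (- (11 / 10 * L)) + expR (- (11 / 10 * L))); last by ring.
have degn : (degree (complete_graph 'I_n) v)%:R <= n%:R :> R.
  by rewrite ler_nat -[X in (_ <= X)%N]card_ord degree_complete_le.
have pd : p * (degree (complete_graph 'I_n) v)%:R <= m.
  by rewrite mE mulrC ler_wpM2r.
have pd' : (1 - 10^-1 * 10^-1 * 10^-1) * m <=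
    p * (degree (complete_graph 'I_n) v)%:R.
  apply: le_trans (ler_wpM2l p0 (degK v)); rewrite mE.
  have -> : p * ((1 - eps) * n%:R) = (1 - eps) * (n%:R * p) by ring.
  by rewrite ler_wpM2r ?mulr_ge0 //; lra.
rewrite /failure_exponent /upper_exponent /lower_exponent.
rewrite set0I setU0 setD0 !degree0 !mulr0n !subr0.
move: (degree _ v)%:R pd pd' => D pd pd'; clear - Lle L60 mE mL pd pd'.
(* The exponents are [(5/2 - 18/5) eps m], at most [(2 - 3) m], and at most [(9/200 - 999/21000) m];
   with [eps m >= L] and [m >= 1000 L] each is at most [- 11/10 L]. *)
apply: lerD; [apply: lerD|]; rewrite ler_expR.
- have -> : 0 - 18 / 5 * (eps * n%:R * p) + 2 * p * (5 / 4 * (eps * n%:R)) =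
    - (11 / 10 * (eps * m)) by rewrite mE; field.
  lra.
- rewrite -mE; lra.
- rewrite -mE; lra.
Qed.

Lemma in_progress_legal (R : realType) (T : finType) (board : {set {set T}})
    (b : R) s : in_progress board b s ->
  walker_edges s \subset board :\: breaker_edges s.
Proof.
elim=> [v f|s1 s2 _]; first by rewrite sub0set.
exact: step_walker_sub.
Qed.

Theorem theorem2p3 (R : realType) (eps : R) (p : nat -> R) (P : property)
  (eps_gt0 : 0 < eps) (eps_lt : eps < 10 ^- 5)
  (p_bounds : (\forall n \near \oo,
     ln n%:R / (eps * n%:R) <= p n /\ p n <= 1)%classic)
  (P_graph : graph_property P) (P_mono : monotone_increasing P)
  (P_res : resilient p (4 * eps) P) :
  (\forall n \near \oo,
    forall (d : nat) (T : finType) (board : {set {set T}})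
      (phi : 'I_n -> T) (s0 : position T),
    let b := eps / (30 * (d.+1)%:R * p n) in
    board \subset complete_graph T ->
    injective phi ->
    restrict_graph phi board = complete_graph 'I_n ->
    in_progress board b s0 ->
    (exists v : 'I_n, location s0 = phi v) ->
    (1 - eps) * n%:R <= (min_degree (restrict_graph phi (free_edges board s0)))%:R ->
    (forall u v : 'I_n, path_within (walker_edges s0) d (phi u) (phi v)) ->
    exists sigma : strategy T,
      achieves board b sigma s0
        (fun s => P n (restrict_graph phi (walker_edges s :\: walker_edges s0))))%classic.
Proof.
have eps_le : eps * (10 * 10 * 10) <= 1.
  have {}eps_lt : eps * 10 ^+ 5 < 1.
    by rewrite -ltr_pdivlMr ?exprn_gt0 // mul1r.
  apply: le_trans (ltW eps_lt); rewrite ler_pM2l // -expr2 -exprSr.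
  by apply: ler_weXn2l => //; lra.
have P_half := cvgr_gt _ P_res (1 / 2) ltac:(lra).
near=> n.
have [p_lb p_le1] : ln n%:R / (eps * n%:R) <= p n /\ p n <= 1 by near: n.
have prob_half : 1 / 2 < Gnp_prob (p n) (robustly P (4 * eps) (n := n)).
  by near: n.
have n_large : expR 60 <= n%:R :> R by near: n; exact: nbhs_infty_ger.
have n_gt0 : 0 < n%:R :> R by apply: lt_le_trans (expR_gt0 _) n_large.
have n_gt1 : (1 < n)%N.
  by rewrite -(ltr_nat R); apply: lt_le_trans n_large; rewrite expR_gt1.
have L60 : 60 <= ln n%:R :> R.
  by rewrite -[X in X <= _]expRK ler_ln ?posrE ?expR_gt0.
have Lle : ln n%:R <= eps * (n%:R * p n).
  by move: p_lb; rewrite ler_pdivrMr ?mulr_gt0 // mulrC -mulrA.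
have p_gt0 : 0 < p n.
  apply: lt_le_trans p_lb; rewrite divr_gt0 ?mulr_gt0 //; lra.
move=> d T board phi s0 _ phi_inj restr_board prog [v0 lv0] mindeg paths.
have [b bE] : {b | b = eps / (30 * d.+1%:R * p n)} by eexists.
rewrite -bE in prog *.
have legal := in_progress_legal prog.
have F0_deg v :
    (1 - eps) * n%:R <= (degree (restrict_graph phi (free_edges board s0)) v)%:R.
  by apply: le_trans mindeg _; rewrite ler_nat min_degree_le.
have K_deg v : (1 - eps) * n%:R <= (degree (complete_graph 'I_n) v)%:R.
  by apply: le_trans (F0_deg v) _; rewrite ler_nat degreeS ?restrict_graph_sub.
have b_ge0 : 0 <= b by rewrite bE divr_ge0 ?mulr_ge0 // ltW.
(* The factor [30 (d + 1)] in [b] makes [beta] independent of [d]. *)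
have betaE : eps / (15 * p n) = 2 * b * d.+1%:R.
  by rewrite bE; field; rewrite (gt_eqF p_gt0) nat1r pnatr_eq0.
have lost_deg v : (degree (complete_graph 'I_n :\:
    restrict_graph phi (free_edges board s0)) v)%:R <= eps * n%:R.
  have := degreeID (complete_graph 'I_n)
    (restrict_graph phi (free_edges board s0)) v.
  rewrite (setIidPr (restrict_graph_sub _ _)).
  move=> /(congr1 (fun k => k%:R : R)); rewrite natrD.
  have : (degree (complete_graph 'I_n) v)%:R <= n%:R :> R.
    by rewrite ler_nat -[X in (_ <= X)%N]card_ord degree_complete_le.
  move: (degree _ v)%:R (degree _ v)%:R (degree _ v)%:R (F0_deg v) => D1 D2 D3.
  by clear; lra.
have m_ge0 : 0 <= n%:R * p n by rewrite mulr_ge0 // ltW.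
(* The term [3 n p] uses [eps n / 5] of the available [eps n / 4]; the remaining [eps n / 20] covers
   [ln n + 2 <= 3/4 n p]. *)
have budget : eps * n%:R + eps / (15 * p n) * (3 * (n%:R * p n) + ln n%:R + 2)
    <= 5 / 4 * (eps * n%:R).
  have np5 : ln n%:R + 2 <= 3 / 4 * (n%:R * p n).
    have := ler_wpM2r m_ge0 eps_le; rewrite mulrAC mul1r => npL.
    by clear - Lle L60 m_ge0 npL; lra.
  have -> : eps * n%:R + eps / (15 * p n) * (3 * (n%:R * p n) + ln n%:R + 2) =
      6 / 5 * (eps * n%:R) + eps / (15 * p n) * (ln n%:R + 2).
    by field; rewrite gt_eqF.
  have e0 : 0 <= eps / (15 * p n) by rewrite divr_ge0 ?mulr_ge0 // ltW.
  have := ler_wpM2l e0 np5.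
  have -> : eps / (15 * p n) * (3 / 4 * (n%:R * p n)) = 20^-1 * (eps * n%:R).
    by field; rewrite gt_eqF.
  by clear; lra.
apply: wins_strategy.
  (* The path in Walker's graph from [v0] to a second vertex begins with an edge that she owns at
     her location. *)
  split=> //; have [u uv0] : exists u, u != v0.
    have /card_gt0P[u] : (0 < #|[set~ v0]|)%N.
      by rewrite cardsC1 card_ord -ltnS prednK // ltnW.
    by rewrite !inE; exists u.
  have [[|w r] [/= pr _ lr _]] := paths v0 u.
    by rewrite (phi_inj _ _ lr) eqxx in uv0.
  by exists w; rewrite lv0; case/andP: pr.
have pot0 := initial_potential (ltW p_gt0) eps_gt0 eps_le Lle L60 K_deg
  prob_half.
exact: (start_wins (ltW p_gt0) p_le1 (ltW eps_gt0) b_ge0 betaE P_mono phi_inj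
  restr_board lost_deg budget paths (erefl _) (erefl _) lv0 legal pot0).
Unshelve. all: by end_near.
Qed.
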